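(* Let $\mathbb{T}=\mathbb{R}\cup\{-\infty\}$ be the real tropical semifield, and let $M$ be a separated $\mathbb{T}$-semimodule (whose canonical distance is well defined). Then the canonical distance $d:\mathbb{P}(M)\times\mathbb{P}(M)\to\mathbb{R}_{\ge0}\cup\{+\infty\}$ satisfies $$\forall x,y,z\in\mathbb{P}(M):\quad d(x,y)\le d(x,z)+d(z,y).$$
   Context: **Semimodules.** On $\mathbb{T}=\mathbb{R}\cup\{-\infty\}$ put $a\oplus b=\max(a,b)$, $a\odot b=a+b$ (and $a\odot(-\infty)=-\infty$); $0_{\mathbb{T}}=-\infty$, $1_{\mathbb{T}}=0$, $\mathbb{T}^*=\mathbb{R}$. A $\mathbb{T}$-semimodule is a set $M$ with an associative commutative operation $\oplus$ having neutral element $0$, and a product $\odot:\mathbb{T}\times M\to M$ satisfying the usual associative and distributive properties, with $1_{\mathbb{T}}\odot v=v$ and $0_{\mathbb{T}}\odot v=0$. Linear maps are maps preserving $\oplus$ and $\odot$; submodules are subsets closed under the operations. $\mathbb{T}^n$ is the free semimodule with componentwise operations and canonical basis $e_1,\dots,e_n$. **Projective spaces.** $\mathbb{P}(M)=(M\setminus\{0\})/\sim$, where $x\sim y$ iff $x=\lambda\odot y$ for some $\lambda\in\mathbb{T}^*$. A linear map sending no nonzero element to $0$ induces a map (a projective map) of projective spaces. $\mathbb{TP}^1=\mathbb{P}(\mathbb{T}^2)$ is identified with $\mathbb{R}\cup\{\pm\infty\}$ by $[x^1:x^2]\mapsto x^1-x^2$, with the corresponding order and topology; write $0_{\mathbb{T}}=[0_{\mathbb{T}}:1_{\mathbb{T}}]=-\infty$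 and $\infty_{\mathbb{T}}=[1_{\mathbb{T}}:0_{\mathbb{T}}]=+\infty$ for the endpoints. **Separated.** Let $B$ be the quotient semimodule of $\mathbb{T}^2$ by the relation: $(x^1,x^2)\sim(y^1,y^2)$ iff either ($x^1<x^2$, $y^1<y^2$ and $x^2=y^2$) or ($x^1\ge x^2$, $y^1\ge y^2$ and $x^1=y^1$). $M$ is separated if it contains no submodule isomorphic to $B$. **Canonical distance.** For $a\ne b$ in $\mathbb{P}(M)$ choose lifts $\bar a,\bar b\in M$ and let $f:\mathbb{TP}^1\to\mathbb{P}(M)$ be the projective map induced by the linear map $\bar f:\mathbb{T}^2\to M$ with $\bar f(e_1)=\bar b$, $\bar f(e_2)=\bar a$, so $f(0_{\mathbb{T}})=a$, $f(\infty_{\mathbb{T}})=b$. The sets $f^{-1}(a)$ and $f^{-1}(b)$ are a closed initial segment $[-\infty,a_0]$ and a closed final segment $[b_0,+\infty]$ of $\mathbb{TP}^1$ (this is what is meant by $d$ being well defined), and $d(a,b)=b_0-a_0\in[0,+\infty]$, the Euclidean distance of the extremal points; this does not depend on the lifts. Also $d(a,a)=0$. *)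

(* Defs.v *)
From HB Require Import structures.
From mathcomp Require Import all_boot all_order all_algebra.
From mathcomp Require Import generic_quotient.
From mathcomp Require Import all_classical all_reals.
From mathcomp Require Import ereal.
From mathcomp Require Import ring.

Set Implicit Arguments.
Unset Strict Implicit.
Unset Printing Implicit Defensive.

Import Order.TTheory GRing.Theory Num.Theory.

Local Open Scope classical_set_scope.
Local Open Scope quotient_scope.
Local Open Scope ring_scope.

(* The tropical semifield R U {-oo}.  In [ring_scope] the operations [+] and
   [*] of [trop R] are the tropical sum (max) and product (ordinary sum), so
   that the ring constants [0] and [1] are -oo and the real number 0. *)
Record trop (R : realType) := Trop {
  trop_val : \bar R;
  _ : trop_val != +oo%E }.

HB.instance Definition _ (R : realType) := [isSub for @trop_val R].
HB.instance Definition _ (R : realType) := [Choice of trop R by <:].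

Section TropicalSemifield.
Variable R : realType.
Implicit Types a b c : trop R.

Fact trop_zero_subproof : (-oo : \bar R)%E != +oo%E. Proof. by []. Qed.
Fact trop_one_subproof : (0 : \bar R)%E != +oo%E. Proof. by []. Qed.
Fact trop_add_subproof a b : Order.max (trop_val a) (trop_val b) != +oo%E.
Proof. by case: a b => [a a_fin] [b b_fin] /=; case: ltP. Qed.
Fact trop_mul_subproof a b : (trop_val a + trop_val b)%E != +oo%E.
Proof. by case: a b => [[a| |] //= _] [[b| |] //= _]. Qed.

Definition trop_zero := Trop trop_zero_subproof.
Definition trop_one := Trop trop_one_subproof.
Definition trop_add a b := Trop (trop_add_subproof a b).
Definition trop_mul a b := Trop (trop_mul_subproof a b).

Fact trop_addA : associative trop_add.
Proof. by move=> a b c; apply: val_inj; rewrite /= maxA. Qed.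
Fact trop_addC : commutative trop_add.
Proof. by move=> a b; apply: val_inj; rewrite /= maxC. Qed.
Fact trop_add0 : left_id trop_zero trop_add.
Proof. by move=> a; apply: val_inj; rewrite /= maxNye. Qed.

HB.instance Definition _ :=
  GRing.isNmodule.Build (trop R) trop_addA trop_addC trop_add0.

Fact trop_mulA : associative trop_mul.
Proof. by move=> a b c; apply: val_inj; rewrite /= addeA. Qed.
Fact trop_mulC : commutative trop_mul.
Proof. by move=> a b; apply: val_inj; rewrite /= addeC. Qed.
Fact trop_mul1 : left_id trop_one trop_mul.
Proof. by move=> a; apply: val_inj; rewrite /= add0e. Qed.
Fact trop_mulDl : left_distributive trop_mul +%R.
Proof. by move=> a b c; apply: val_inj; rewrite /= adde_maxl. Qed.
Fact trop_mul0 : left_zero 0 trop_mul.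
Proof. by move=> a; apply: val_inj; rewrite /= addNye. Qed.
Fact trop_one_neq0 : trop_one != 0.
Proof. by []. Qed.

HB.instance Definition _ := GRing.Nmodule_isComNzSemiRing.Build (trop R)
  trop_mulA trop_mulC trop_mul1 trop_mulDl trop_mul0 trop_one_neq0.

Definition trop_real (r : R) : trop R := @Trop R r%:E isT.

Lemma trop_val0 : trop_val (0 : trop R) = -oo%E. Proof. by []. Qed.
Lemma trop_val1 : trop_val (1 : trop R) = 0%E. Proof. by []. Qed.
Lemma trop_valD a b : trop_val (a + b) = Order.max (trop_val a) (trop_val b).
Proof. by []. Qed.
Lemma trop_valM a b : trop_val (a * b) = (trop_val a + trop_val b)%E.
Proof. by []. Qed.

Lemma trop_neq0P a : reflect (exists r, a = trop_real r) (a != 0).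
Proof.
apply: (iffP idP) => [|[r ->] //]; case: a => [[r| |] //= ar] a0.
by exists r; apply: val_inj.
Qed.

Lemma trop_realM r s : trop_real r * trop_real s = trop_real (r + s).
Proof. exact: val_inj. Qed.

Lemma trop_realVl r : trop_real (- r) * trop_real r = 1.
Proof. by apply: val_inj; rewrite /= -EFinD addNr. Qed.

Lemma trop_addbb a : a + a = a.
Proof. by apply: val_inj; rewrite /= maxxx. Qed.

End TropicalSemifield.

Section Semimodules.
Variables (R : realType) (M : lSemiModType (trop R)).

Lemma semimod_addvv (v : M) : v + v = v.
Proof. by rewrite -[v]scale1r -scalerDl trop_addbb. Qed.

Lemma semimod_add_eq0 (u v : M) : u + v = 0 -> u = 0 /\ v = 0.
Proof.
move=> uv0; split.
  by rewrite -[LHS]addr0 -uv0 addrA semimod_addvv.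
by rewrite -[LHS]add0r -uv0 -addrA semimod_addvv.
Qed.

Lemma semimod_scale_eq0 (a : trop R) (v : M) :
  a != 0 -> a *: v = 0 -> v = 0.
Proof.
move=> /trop_neq0P[r ->] /(congr1 ( *:%R (trop_real (- r)))).
by rewrite scalerA trop_realVl scale1r scaler0.
Qed.

End Semimodules.

Section ProjectiveSpace.
Variables (R : realType) (M : lSemiModType (trop R)).

Definition nonzero := {v : M | v != 0}.

Definition proj_rel (u v : nonzero) : bool :=
  `[< exists a : trop R, a != 0 /\ val u = a *: val v >].

Fact proj_rel_refl : reflexive proj_rel.
Proof. by move=> u; apply/asboolP; exists 1; rewrite oner_neq0 scale1r. Qed.

Fact proj_rel_sym : symmetric proj_rel.
Proof.
suff imp u v : proj_rel u v -> proj_rel v u.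
  by move=> u v; apply/idP/idP; apply: imp.
move=> /asboolP[a [/trop_neq0P[r ->] uv]]; apply/asboolP.
by exists (trop_real (- r)); rewrite uv scalerA trop_realVl scale1r.
Qed.

Fact proj_rel_trans : transitive proj_rel.
Proof.
move=> v u w /asboolP[a [/trop_neq0P[r ->] uv]].
move=> /asboolP[b [/trop_neq0P[s ->] vw]]; apply/asboolP.
by exists (trop_real (r + s)); rewrite uv vw scalerA trop_realM.
Qed.

Canonical proj_rel_equiv :=
  EquivRel proj_rel proj_rel_refl proj_rel_sym proj_rel_trans.

Definition projspace := {eq_quot proj_rel}.
HB.instance Definition _ : EqQuotient _ proj_rel projspace :=
  EqQuotient.on projspace.
HB.instance Definition _ := Choice.on projspace.

Lemma projspaceP (u v : nonzero) :
  \pi_projspace u = \pi_projspace v <->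
  exists a : trop R, a != 0 /\ val u = a *: val v.
Proof. by split=> [/eqmodP/asboolP|uv]; last exact/eqmodP/asboolP. Qed.

End ProjectiveSpace.

Section ProjectiveMap.
Variables (R : realType) (U V : lSemiModType (trop R)).
Variables (g : {linear U -> V}) (g_neq0 : forall u : U, u != 0 -> g u != 0).

Definition nonzero_map (u : nonzero U) : nonzero V :=
  exist _ (g (val u)) (g_neq0 (valP u)).

Definition proj_map : projspace U -> projspace V :=
  lift_op11 (projspace U) (projspace V) nonzero_map.

Lemma proj_mapE (u : nonzero U) :
  proj_map (\pi u) = \pi_(projspace V) (nonzero_map u).
Proof.
rewrite /proj_map; unlock; apply/projspaceP.
have /projspaceP[a [a0 ua]] : \pi_(projspace U) (repr (\pi_(projspace U) u)) =
  \pi_(projspace U) u by rewrite reprK.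
by exists a; rewrite /= ua linearZ.
Qed.

End ProjectiveMap.

Section TropicalPlane.
Variable R : realType.

Definition tplane := ((trop R)^o * (trop R)^o)%type.
HB.instance Definition _ := GRing.LSemiModule.on tplane.

Implicit Types x y : tplane.

Definition tplane_e1 : tplane := (1, 0).
Definition tplane_e2 : tplane := (0, 1).

Definition TP1 := projspace tplane.

(* The identification of TP1 with [-oo, +oo] given by [x1 : x2] |-> x1 - x2;
   the difference is well defined because x1 and x2 are not both -oo. *)
Definition TP1_coord : TP1 -> \bar R :=
  lift_fun1 TP1 (fun x : nonzero tplane =>
    trop_val (val x).1 - trop_val (val x).2)%E.

Lemma TP1_coordE (x : nonzero tplane) :
  TP1_coord (\pi x) = (trop_val (val x).1 - trop_val (val x).2)%E.
Proof.
rewrite /TP1_coord; unlock.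
have /projspaceP[a [/trop_neq0P[r ->] ->]] :
  \pi_TP1 (repr (\pi_TP1 x)) = \pi_TP1 x by rewrite reprK.
case: x => -[[[x1| |] //= ?] [[x2| |] //= ?]] x0 //=.
rewrite -!EFinD; congr _%:E; rewrite opprD addrACA subrr add0r //.
Qed.

Lemma TP1_coord_inj : injective TP1_coord.
Proof.
elim/quotW=> x; elim/quotW=> y; rewrite !TP1_coordE => xy.
apply/projspaceP.
case: x y xy => -[[[x1| |] //= ?] [[x2| |] //= ?]] x0;
  case=> -[[[y1| |] //= ?] [[y2| |] //= ?]] y0 //= xy.
- exists (trop_real (x1 - y1)); split=> //.
  case: xy => xy; congr (_, _); apply: val_inj => /=; rewrite -EFinD.
    by rewrite subrK.
  by congr _%:E; rewrite -[x1](subrK x2) xy; ring.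
- exists (trop_real (x1 - y1)); split=> //.
  by congr (_, _); apply: val_inj => //=; rewrite -EFinD subrK.
exists (trop_real (x2 - y2)); split=> //.
by congr (_, _); apply: val_inj => //=; rewrite -EFinD subrK.
Qed.

Lemma TP1_coord_surj (e : \bar R) : exists p, TP1_coord p = e.
Proof.
case: e => [r| |].
- have x0 : ((trop_real r, 1) : tplane) != 0 by [].
  exists (\pi_TP1 (exist _ (trop_real r, 1) x0)).
  by rewrite TP1_coordE /= oppr0 adde0.
- have x0 : tplane_e1 != 0 by [].
  by exists (\pi_TP1 (exist _ tplane_e1 x0)); rewrite TP1_coordE.
have x0 : tplane_e2 != 0 by [].
by exists (\pi_TP1 (exist _ tplane_e2 x0)); rewrite TP1_coordE.
Qed.

(* The semimodule B, the quotient of the tropical plane by [B_rel]. *)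
Definition B_rel x y : bool :=
  let x1 := trop_val x.1 in let x2 := trop_val x.2 in
  let y1 := trop_val y.1 in let y2 := trop_val y.2 in
  [&& (x1 < x2)%E, (y1 < y2)%E & x2 == y2] ||
  [&& (x1 >= x2)%E, (y1 >= y2)%E & x1 == y1].

Fact B_rel_refl : reflexive B_rel.
Proof. by move=> x; rewrite /B_rel !eqxx !andbT !andbb; case: ltP. Qed.

Fact B_rel_sym : symmetric B_rel.
Proof.
move=> x y; rewrite /B_rel; congr (_ || _).
  by rewrite andbCA eq_sym.
by rewrite andbCA eq_sym.
Qed.

Fact B_rel_trans : transitive B_rel.
Proof.
move=> y x z; rewrite /B_rel /=.
case: (ltP (trop_val x.1) (trop_val x.2)) => _;
  case: (ltP (trop_val y.1) (trop_val y.2)) => _;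
  case: (ltP (trop_val z.1) (trop_val z.2)) => _ //=; rewrite ?orbF;
  by move=> /eqP-> /eqP->.
Qed.

Canonical B_rel_equiv := EquivRel B_rel B_rel_refl B_rel_sym B_rel_trans.

Definition Bsemimod := {eq_quot B_rel}.
HB.instance Definition _ : EqQuotient _ B_rel Bsemimod :=
  EqQuotient.on Bsemimod.
HB.instance Definition _ := Choice.on Bsemimod.

Definition B_zero : Bsemimod := lift_cst Bsemimod (0 : tplane).
Definition B_add := lift_op2 Bsemimod (fun x y : tplane => x + y).
Definition B_scale (a : trop R) := lift_op1 Bsemimod (fun x : tplane => a *: x).


Let B_relD_mixed (x1 x2 x1' y1 y2 y2' : \bar R) :
  (x1 < x2)%E -> (x1' < x2)%E -> (y2 <= y1)%E -> (y2' <= y1)%E ->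
  [&& Order.max x1 y1 < Order.max x2 y2, Order.max x1' y1 < Order.max x2 y2'
    & Order.max x2 y2 == Order.max x2 y2']%E ||
  [&& Order.max x1 y1 >= Order.max x2 y2, Order.max x1' y1 >= Order.max x2 y2'
    & Order.max x1 y1 == Order.max x1' y1]%E.
Proof.
move=> x12 x12' y21 y21'; have [yx|xy] := ltP y1 x2.
  have y2x := le_trans y21 (ltW yx); have y2x' := le_trans y21' (ltW yx).
  by rewrite !(max_l y2x) !(max_l y2x') !gt_max x12 x12' yx eqxx.
have x1y := le_trans (ltW x12) xy; have x1y' := le_trans (ltW x12') xy.
by rewrite !(max_r x1y) !(max_r x1y') !ge_max xy y21 y21' eqxx orbT.
Qed.

Lemma B_relD x x' y y' : B_rel x x' -> B_rel y y' -> B_rel (x + y) (x' + y').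
Proof.
rewrite {1 2}/B_rel => /orP[]/and3P[xl xl' /eqP ex]
  /orP[]/and3P[yl yl' /eqP ey].
- rewrite /B_rel /= -ex -ey eqxx.
  by rewrite !gt_max !lt_max xl yl ex xl' ey yl' !orbT.
- by rewrite /B_rel /= -ex -ey B_relD_mixed // ?ex ?ey.
- rewrite addrC (addrC x').
  by rewrite /B_rel /= -ex -ey B_relD_mixed // ?ex ?ey.
rewrite /B_rel /= -ex -ey eqxx.
by rewrite !ge_max !le_max xl yl ex xl' ey yl' !orbT.
Qed.

Lemma B_relZ a x y : B_rel x y -> B_rel (a *: x) (a *: y).
Proof.
have [->|/trop_neq0P[r ->]] := eqVneq a 0; first by rewrite !scale0r B_rel_refl.
rewrite /B_rel /= !lteD2lE // !leeD2lE //.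
by move=> /orP[]/and3P[-> -> /eqP ->]; rewrite eqxx ?orbT.
Qed.

Lemma pi_B_zero : \pi_Bsemimod 0 = B_zero.
Proof. by rewrite /B_zero; unlock. Qed.

Lemma pi_B_add x y : \pi_Bsemimod (x + y) = B_add (\pi x) (\pi y).
Proof.
rewrite /B_add; unlock; apply/esym/eqmodP.
by apply: B_relD; apply/eqmodP; rewrite reprK.
Qed.

Lemma pi_B_scale a x : \pi_Bsemimod (a *: x) = B_scale a (\pi x).
Proof.
rewrite /B_scale; unlock; apply/esym/eqmodP.
by apply: B_relZ; apply/eqmodP; rewrite reprK.
Qed.

Fact B_addA : associative B_add.
Proof.
by elim/quotW=> x; elim/quotW=> y; elim/quotW=> z; rewrite -!pi_B_add addrA.
Qed.
Fact B_addC : commutative B_add.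
Proof. by elim/quotW=> x; elim/quotW=> y; rewrite -!pi_B_add addrC. Qed.
Fact B_add0 : left_id B_zero B_add.
Proof. by elim/quotW=> x; rewrite -pi_B_zero -pi_B_add add0r. Qed.

HB.instance Definition _ :=
  GRing.isNmodule.Build Bsemimod B_addA B_addC B_add0.

Lemma pi_BD x y : \pi_Bsemimod (x + y) = \pi_Bsemimod x + \pi_Bsemimod y.
Proof. exact: pi_B_add. Qed.

Fact B_scaleA a b v : B_scale a (B_scale b v) = B_scale (a * b) v.
Proof. by elim/quotW: v => x; rewrite -!pi_B_scale scalerA. Qed.
Fact B_scale0 v : B_scale 0 v = 0.
Proof. by elim/quotW: v => x; rewrite -pi_B_scale scale0r pi_B_zero. Qed.
Fact B_scale1 : left_id 1 B_scale.
Proof. by elim/quotW=> x; rewrite -pi_B_scale scale1r. Qed.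
Fact B_scaleDr : right_distributive B_scale +%R.
Proof.
move=> a; elim/quotW=> x; elim/quotW=> y.
by rewrite -pi_BD -!pi_B_scale scalerDr pi_BD.
Qed.
Fact B_scaleDl v : {morph B_scale^~ v : a b / a + b}.
Proof.
by elim/quotW: v => x a b; rewrite -!pi_B_scale scalerDl pi_BD.
Qed.

HB.instance Definition _ := GRing.Nmodule_isLSemiModule.Build (trop R) Bsemimod
  B_scaleA B_scale0 B_scale1 B_scaleDr B_scaleDl.

End TropicalPlane.

Definition separated_semimodule (R : realType) (M : lSemiModType (trop R)) :
    Prop :=
  ~ exists N : {pred M}, subsemimod_closed N /\
    exists f : {linear Bsemimod R -> M}, set_bij [set: Bsemimod R] [set` N] f.

Section CanonicalDistance.
Variables (R : realType) (M : lSemiModType (trop R)).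
Implicit Types (u v : nonzero M) (a b : projspace M).

Section Line.
Variables u v : nonzero M.

Definition line_lin (x : tplane R) : M := x.1 *: val v + x.2 *: val u.

Fact line_lin_semilinear : semilinear line_lin.
Proof.
rewrite /line_lin; split=> [a x|x y] /=; first by rewrite scalerDr !scalerA.
by rewrite !scalerDl addrACA.
Qed.

HB.instance Definition _ := GRing.isSemilinear.Build (trop R) (tplane R) M
  *:%R line_lin line_lin_semilinear.

Lemma line_lin_e1 : line_lin (tplane_e1 R) = val v.
Proof. by rewrite /line_lin /= scale1r scale0r addr0. Qed.

Lemma line_lin_e2 : line_lin (tplane_e2 R) = val u.
Proof. by rewrite /line_lin /= scale1r scale0r add0r. Qed.

Fact line_lin_neq0 x : x != 0 -> line_lin x != 0.
Proof.
apply: contra_neq => /semimod_add_eq0[x1 x2]; case: x x1 x2 => x1 x2 /= h1 h2.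
congr pair; apply: contraTeq isT => xi0.
  by have /eqP[] := valP v; apply: semimod_scale_eq0 h1.
by have /eqP[] := valP u; apply: semimod_scale_eq0 h2.
Qed.

(* The projective map TP1 -> P(M) sending -oo to [u] and +oo to [v]. *)
Definition line : TP1 R -> projspace M := proj_map line_lin_neq0.

End Line.

(* The canonical distance is well defined: whatever the lifts [u] and [v] of
   two distinct points, the fibres of [line u v] over them are a closed initial
   and a closed final segment of TP1. *)
Definition canonical_distance_well_defined : Prop :=
  forall u v, \pi_(projspace M) u != \pi v ->
  exists a0 b0 : \bar R,
    line u v @^-1` [set \pi u] = [set p | (TP1_coord p <= a0)%E] /\
    line u v @^-1` [set \pi v] = [set p | (b0 <= TP1_coord p)%E].

(* The supremum and infimum are the extremal points a0 and b0 of the fibres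
   whenever the distance is well defined. *)
Definition canonical_distance a b : \bar R :=
  if a == b then 0%E else
  let f := line (repr a) (repr b) in
  (ereal_inf (@TP1_coord R @` (f @^-1` [set b])) -
   ereal_sup (@TP1_coord R @` (f @^-1` [set a])))%E.

Lemma line_scale (r s : R) u v u' v' (p q : TP1 R) :
  val u' = trop_real r *: val u -> val v' = trop_real s *: val v ->
  TP1_coord q = (TP1_coord p + (s - r)%:E)%E -> line u' v' p = line u v q.
Proof.
move=> u'E v'E; elim/quotW: p => x.
have y0 : ((trop_real s * (val x).1, trop_real r * (val x).2) : tplane R) != 0.
  apply: contra (valP x) => /eqP sx0.
  have x1 := @semimod_scale_eq0 R (trop R)^o (trop_real s) (val x).1 isT
    (congr1 fst sx0).
  have x2 := @semimod_scale_eq0 R (trop R)^o (trop_real r) (val x).2 isT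
    (congr1 snd sx0).
  by rewrite [val x]surjective_pairing x1 x2.
pose y : nonzero (tplane R) :=
    exist (fun w : tplane R => w != 0) _ y0.
have yE : TP1_coord (\pi_(TP1 R) y) =
    (TP1_coord (\pi_(TP1 R) x) + (s - r)%:E)%E.
  rewrite !TP1_coordE /=; case: (val x) => -[[x1| |] //= ?] [[x2| |] //= ?] //=.
  by rewrite -!EFinD opprD addrACA addrC.
rewrite -yE => /TP1_coord_inj->; rewrite /line !proj_mapE; congr \pi.
by apply: val_inj; rewrite /= /line_lin u'E v'E !scalerA mulrC
   [(val x).2 * _]mulrC.
Qed.

(* The value does not depend on the choice of the lifts. *)
Lemma canonical_distanceE u v (a0 b0 : \bar R) :
  \pi_(projspace M) u != \pi v ->
  line u v @^-1` [set \pi u] = [set p | (TP1_coord p <= a0)%E] ->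
  line u v @^-1` [set \pi v] = [set p | (b0 <= TP1_coord p)%E] ->
  canonical_distance (\pi u) (\pi v) = (b0 - a0)%E.
Proof.
move=> uv; rewrite /canonical_distance (negbTE uv).
have /projspaceP[_ [/trop_neq0P[r ->] ru]] :
  \pi_(projspace M) (repr (\pi_(projspace M) u)) = \pi u by rewrite reprK.
have /projspaceP[_ [/trop_neq0P[s ->] sv]] :
  \pi_(projspace M) (repr (\pi_(projspace M) v)) = \pi v by rewrite reprK.
set u' : nonzero M := repr (\pi u) in ru *.
set v' : nonzero M := repr (\pi v) in sv *.
move=> fa fb /=.
have lineE p q : TP1_coord q = (TP1_coord p + (s - r)%:E)%E ->
  line u' v' p = line u v q by apply: line_scale.
have fibre (c : projspace M) (P : set (\bar R)) :
  line u v @^-1` [set c] = [set p | P (TP1_coord p)] ->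
  @TP1_coord R @` (line u' v' @^-1` [set c]) =
    [set e | P (e + (s - r)%:E)%E].
  move=> cP; apply/seteqP; split=> [_ [p /= pc <-]|e /= Pe].
    have [q qp] := TP1_coord_surj (TP1_coord p + (s - r)%:E)%E.
    rewrite -qp; have : (line u v @^-1` [set c]) q by rewrite /= -(lineE p).
    by rewrite cP.
  have [p pe] := TP1_coord_surj e; exists p => //=.
  have [q qp] := TP1_coord_surj (TP1_coord p + (s - r)%:E)%E.
  rewrite (lineE _ _ qp).
  suff : (line u v @^-1` [set c]) q by [].
  by rewrite cP /= qp pe.
rewrite (fibre _ (fun e => e <= a0)%E fa) (fibre _ (fun e => b0 <= e)%E fb).
have -> : ereal_sup [set e : \bar R | (e + (s - r)%:E <= a0)%E] =
    (a0 - (s - r)%:E)%E.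
  apply/eqP; rewrite eq_le; apply/andP; split.
    by apply: ge_ereal_sup => e; rewrite leeBrDr.
  by apply: ereal_sup_ubound; rewrite /mkset subeK.
have -> : ereal_inf [set e : \bar R | (b0 <= e + (s - r)%:E)%E] =
    (b0 - (s - r)%:E)%E.
  apply/eqP; rewrite eq_le; apply/andP; split.
    by apply: ereal_inf_lbound; rewrite /mkset subeK.
  by apply: le_ereal_inf_tmp => e; rewrite leeBlDr.
case: a0 b0 {fa fb} => [a0| |] [b0| |] //=.
by rewrite -!EFinB; congr _%:E; ring.
Qed.

Lemma canonical_distance_ge0 a b :
  canonical_distance_well_defined -> (0 <= canonical_distance a b)%E.
Proof.
move=> wd; elim/quotW: a => u; elim/quotW: b => v.
have [->|uv] := eqVneq (\pi_(projspace M) u) (\pi v).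
  by rewrite /canonical_distance eqxx.
have [a0 [b0 [fa fb]]] := wd u v uv; rewrite (canonical_distanceE uv fa fb).
suff ab : (a0 < b0)%E.
  case: a0 b0 ab {fa fb} => [a0| |] [b0| |] //=; rewrite ?leey //.
  by rewrite lte_fin lee_fin subr_ge0 => /ltW.
have [//|ba] := ltP a0 b0; have [p pa] := TP1_coord_surj a0.
have pu : (line u v @^-1` [set \pi_(projspace M) u]) p by rewrite fa /= pa.
have pv : (line u v @^-1` [set \pi_(projspace M) v]) p by rewrite fb /= pa.
by move: uv; rewrite -pu -pv eqxx.
Qed.

End CanonicalDistance.

(* Main.v *)
Require Import Defs.
From HB Require Import structures.
From mathcomp Require Import all_boot all_order all_algebra.
From mathcomp Require Import generic_quotient.
From mathcomp Require Import all_classical all_reals.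
From mathcomp Require Import ereal.

(** Order [M] by [u <= v] iff [u + v = v].  If [t v + u = l u] with [l > 0],
    then, writing [w = (t - l) v], one gets [w + (- e) u = u] for all [e > 0], so
    that the fibre of the line from [u] to [v] over [u] is everything but the
    endpoint, and is not closed.  Hence the fibre over [u] consists of the [t]
    with [t v <= u], so [d(u, v)] is the opposite of
    [max {t | t v <= u} + max {s | s u <= v}], and the triangle inequality is
    transitivity: [s z <= u] and [t v <= z] give [(s + t) v <= u]. *)

Set Implicit Arguments.
Unset Strict Implicit.
Unset Printing Implicit Defensive.

Import Order.TTheory GRing.Theory Num.Theory.

Local Open Scope classical_set_scope.
Local Open Scope quotient_scope.
Local Open Scope ring_scope.

Section SemimoduleOrder.
Variables (R : realType) (M : lSemiModType (trop R)).
Implicit Types (r s t : R) (u v w : M).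

Lemma scale_trop_realA r s v :
  trop_real r *: (trop_real s *: v) = trop_real (r + s) *: v.
Proof. by rewrite scalerA trop_realM. Qed.

Lemma scale_trop_real0 v : trop_real 0 *: v = v.
Proof. by rewrite -[RHS]scale1r; congr (_ *: _); apply: val_inj. Qed.

Lemma scale_trop_real_le r s v : r <= s ->
  trop_real r *: v + trop_real s *: v = trop_real s *: v.
Proof.
move=> rs; rewrite -scalerDl; congr (_ *: _); apply: val_inj => /=.
by apply: max_r; rewrite lee_fin.
Qed.

Lemma scale_trop_real_le1 r v : r <= 0 -> trop_real r *: v + v = v.
Proof. by move=> /(scale_trop_real_le v); rewrite scale_trop_real0. Qed.

(** Expanding [u] by the first equation and then [w] by the second makes the scaled [v] a summand of
    [u], and the sum is idempotent. *)
Lemma scale_absorb_trans s t u v w :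
  trop_real s *: w + u = u -> trop_real t *: v + w = w ->
  trop_real (s + t) *: v + u = u.
Proof.
move=> <- <-.
by rewrite scalerDr !scale_trop_realA !addrA semimod_addvv.
Qed.

(** Scaling by [- l] gives the conclusion for [e = l]. Substituting that equation into itself yields
    all positive multiples of [l], which are eventually at least [e]. *)
Lemma absorb_all_scales l u w : 0 < l ->
  trop_real l *: w + u = trop_real l *: u ->
  forall e, 0 < e -> w + trop_real (- e) *: u = u.
Proof.
move=> l0 wu.
have step : w + trop_real (- l) *: u = u.
  have := congr1 ( *:%R (trop_real (- l))) wu.
  by rewrite scalerDr !scale_trop_realA addNr !scale_trop_real0.
have iter n : w + trop_real (- (l *+ n.+1)) *: u = u.
  elim: n => [//|n IHn]; rewrite -[RHS]step -{2}IHn scalerDr addrA.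
  rewrite [w + trop_real (- l) *: w]addrC scale_trop_real_le1 ?oppr_le0 ?ltW//.
  by rewrite scale_trop_realA -opprD -mulrS.
move=> e e0; have [n en] : exists n, e <= l *+ n.+1.
  have := archi_boundP (ltW (divr_gt0 e0 l0)).
  rewrite ltr_pdivrMr// => /ltW eb; exists (Num.bound (e / l)).
  by rewrite mulrS -mulr_natl; apply: (le_trans eb); rewrite lerDr ltW.
(* The multiple of [u] by [- e] absorbs the smaller one, which can thus be added for free to make
   [iter] applicable. *)
rewrite -(@scale_trop_real_le (- (l *+ n.+1)) (- e)) ?lerN2//.
by rewrite addrA iter addrC scale_trop_real_le1// oppr_le0 ltW.
Qed.

End SemimoduleOrder.

Section Fibres.
Variables (R : realType) (M : lSemiModType (trop R)).
Implicit Types (u v c : nonzero M) (t : R) (p : TP1 R) (a b : \bar R).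

Lemma line_realP u v c t p : TP1_coord p = t%:E ->
  line u v p = \pi c <->
  exists l, trop_real t *: val v + val u = trop_real l *: val c.
Proof.
have x0 : ((trop_real t, 1) : tplane R) != 0 by [].
pose x : nonzero (tplane R) := exist (fun w : tplane R => w != 0) _ x0.
have <- : TP1_coord (\pi_(TP1 R) x) = t%:E.
  by rewrite TP1_coordE /= oppr0 adde0.
move=> /TP1_coord_inj->; rewrite /line proj_mapE projspaceP /= /line_lin /=.
rewrite scale1r; split=> [[_ [/trop_neq0P[l ->] ?]]|[l ?]]; first by exists l.
by exists (trop_real l).
Qed.

Lemma line_pinfty u v p : TP1_coord p = +oo%E -> line u v p = \pi v.
Proof.
have x0 : tplane_e1 R != 0 by [].
pose x : nonzero (tplane R) := exist (fun w : tplane R => w != 0) _ x0.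
have <- : TP1_coord (\pi_(TP1 R) x) = +oo%E by rewrite TP1_coordE.
move=> /TP1_coord_inj->; rewrite /line proj_mapE; congr \pi.
by apply: val_inj; rewrite /= line_lin_e1.
Qed.

Lemma line_ninfty u v p : TP1_coord p = -oo%E -> line u v p = \pi u.
Proof.
have x0 : tplane_e2 R != 0 by [].
pose x : nonzero (tplane R) := exist (fun w : tplane R => w != 0) _ x0.
have <- : TP1_coord (\pi_(TP1 R) x) = -oo%E by rewrite TP1_coordE.
move=> /TP1_coord_inj->; rewrite /line proj_mapE; congr \pi.
by apply: val_inj; rewrite /= line_lin_e2.
Qed.

(** The point at [+oo] is sent to the class of [v], so it lies outside the fibre. This and its dual
    below rule out indeterminate differences of bounds. *)
Lemma initial_fibre_neq_pinfty u v a : \pi_(projspace M) u != \pi v ->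
  line u v @^-1` [set \pi u] = [set p | (TP1_coord p <= a)%E] -> a != +oo%E.
Proof.
move=> uv fa; apply: contraNneq uv => aE.
have [p pE] := TP1_coord_surj (+oo%E : \bar R).
rewrite -(line_pinfty u v pE) eq_sym; apply/eqP.
by suff : (line u v @^-1` [set \pi u]) p by []; rewrite fa /= aE leey.
Qed.

Lemma final_fibre_neq_ninfty u v b : \pi_(projspace M) u != \pi v ->
  line u v @^-1` [set \pi v] = [set p | (b <= TP1_coord p)%E] -> b != -oo%E.
Proof.
move=> uv fb; apply: contraNneq uv => bE.
have [p pE] := TP1_coord_surj (-oo%E : \bar R).
rewrite -(line_ninfty u v pE); apply/eqP.
by suff : (line u v @^-1` [set \pi v]) p by []; rewrite fb /= bE leNye.
Qed.

Hypothesis wd : canonical_distance_well_defined M.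

(** For [l <= 0] idempotency suffices. For [l > 0] the fibre over [u] would contain arbitrarily
    large real coordinates, although its closed bound is not [+oo]. *)
Lemma scale_eq_absorb u v t l : \pi_(projspace M) u != \pi v ->
  trop_real t *: val v + val u = trop_real l *: val u ->
  trop_real t *: val v + val u = val u.
Proof.
move=> uv tvu; have [l0|l0] := leP l 0.
  rewrite -[RHS](scale_trop_real_le1 _ l0) -tvu.
  by rewrite -addrA semimod_addvv.
have wu : trop_real l *: (trop_real (t - l) *: val v) + val u
    = trop_real l *: val u.
  by rewrite scale_trop_realA [l + _]addrC subrK.
have [a [b [fa _]]] := wd uv.
have a_oo := initial_fibre_neq_pinfty uv fa.
(* Scaling the conclusion of [absorb_all_scales] by [e] puts the point of coordinate [t - l + e] in
   the fibre over [u]. *)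
have large e : 0 < e -> ((t - l + e)%:E <= a)%E.
  move=> e0; have [p pE] := TP1_coord_surj (t - l + e)%:E.
  suff : (line u v @^-1` [set \pi u]) p by rewrite fa /= pE.
  apply/(line_realP _ _ _ pE); exists e.
  rewrite -[in RHS](absorb_all_scales l0 wu e0) scalerDr !scale_trop_realA.
  by rewrite subrr scale_trop_real0 [e + _]addrC.
case: a a_oo large {fa} => [r| |] // _ large; last by have := large 1 ltr01.
(* This choice of [e] exceeds [r - (t - l)], so [t - l + e] passes the supposed bound [r]. *)
have := large _ (ltr_wpDl (normr_ge0 (r - (t - l))) ltr01).
by rewrite lee_fin -lerBrDl => /le_trans/(_ (ler_norm _)); rewrite gerDl ler10.
Qed.

Lemma le_initial_fibre u v a t : \pi_(projspace M) u != \pi v ->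
  line u v @^-1` [set \pi u] = [set p | (TP1_coord p <= a)%E] ->
  (t%:E <= a)%E <-> trop_real t *: val v + val u = val u.
Proof.
move=> uv fa; have [p pE] := TP1_coord_surj (t%:E : \bar R).
have -> : (t%:E <= a)%E = (line u v @^-1` [set \pi u]) p :> Prop.
  by rewrite fa /= pE.
split=> [/(line_realP _ _ _ pE)[l /(scale_eq_absorb uv)]//|tvu].
by apply/(line_realP _ _ _ pE); exists 0; rewrite scale_trop_real0.
Qed.

Lemma ge_final_fibre u v b t : \pi_(projspace M) u != \pi v ->
  line u v @^-1` [set \pi v] = [set p | (b <= TP1_coord p)%E] ->
  (b <= t%:E)%E <-> trop_real (- t) *: val u + val v = val v.
Proof.
move=> uv fb; have [p pE] := TP1_coord_surj (t%:E : \bar R).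
have -> : (b <= t%:E)%E = (line u v @^-1` [set \pi v]) p :> Prop.
  by rewrite fb /= pE.
split=> [/(line_realP _ _ _ pE)[l tvu]|tuv].
  (* Scaling by [- t] exchanges the roles of [u] and [v]. *)
  apply: (@scale_eq_absorb _ _ _ (l - t)); first by rewrite eq_sym.
  have := congr1 ( *:%R (trop_real (- t))) tvu.
  rewrite scalerDr !scale_trop_realA addNr scale_trop_real0.
  by rewrite addrC [- t + l]addrC.
apply/(line_realP _ _ _ pE); exists t.
by rewrite -[in RHS]tuv scalerDr scale_trop_realA subrr scale_trop_real0 addrC.
Qed.

End Fibres.

Theorem proposition5p6 (R : realType) (M : lSemiModType (trop R)) :
  separated_semimodule M -> canonical_distance_well_defined M ->
  forall x y z : projspace M,
    (canonical_distance x y <= canonical_distance x z + canonical_distance z y)%E.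
Proof.
move=> _ wd x y z.
(* Fibre bounds exist only for distinct points, so coincidences are settled first. *)
have [->|] := eqVneq x y.
  by rewrite {1}/canonical_distance eqxx adde_ge0// canonical_distance_ge0.
have [->|] := eqVneq x z.
  by rewrite {2}/canonical_distance eqxx add0e.
have [->|] := eqVneq z y.
  by rewrite {3}/canonical_distance eqxx adde0.
elim/quotW: x => u; elim/quotW: y => v; elim/quotW: z => w wv uw uv.
have [a [b [fa fb]]] := wd _ _ uv.
have [a1 [b1 [fa1 fb1]]] := wd _ _ uw.
have [a2 [b2 [fa2 fb2]]] := wd _ _ wv.
rewrite (canonical_distanceE uv fa fb) (canonical_distanceE uw fa1 fb1).
rewrite (canonical_distanceE wv fa2 fb2).
(* Transitivity makes the initial bounds superadditive and, dually, the final bounds subadditive. *)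
have a_le s t : (s%:E <= a1)%E -> (t%:E <= a2)%E -> ((s + t)%:E <= a)%E.
  move=> /(le_initial_fibre wd _ uw fa1) swu /(le_initial_fibre wd _ wv fa2) tvw.
  by apply/(le_initial_fibre wd _ uv fa); apply: scale_absorb_trans swu tvw.
have b_ge s t : (b1 <= s%:E)%E -> (b2 <= t%:E)%E -> (b <= (s + t)%:E)%E.
  move=> /(ge_final_fibre wd _ uw fb1) suw /(ge_final_fibre wd _ wv fb2) twv.
  apply/(ge_final_fibre wd _ uv fb); rewrite opprD [- s - t]addrC.
  exact: scale_absorb_trans twv suw.
have := initial_fibre_neq_pinfty uv fa.
have := initial_fibre_neq_pinfty uw fa1.
have := initial_fibre_neq_pinfty wv fa2.
have := final_fibre_neq_ninfty uv fb.
have := final_fibre_neq_ninfty uw fb1.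
have := final_fibre_neq_ninfty wv fb2.
move=> {fa fa1 fa2 fb fb1 fb2}.
(* If any of these four bounds is infinite, the right-hand side is [+oo]. *)
case: a1 a_le => [a1| |] a_le; case: a2 a_le => [a2| |] a_le;
  case: b1 b_ge => [b1| |] b_ge; case: b2 b_ge => [b2| |] b_ge //= _ _ b0 _ _ a0;
  rewrite ?leey//.
(* At the extremal points these read [a1 + a2 <= a] and [b <= b1 + b2], which also forces [a] and
   [b] to be real. *)
have := a_le _ _ (lexx _) (lexx _); have := b_ge _ _ (lexx _) (lexx _).
case: a b a0 b0 {a_le b_ge} => [a| |] [b| |] //= _ _.
by rewrite !lee_fin addrACA -opprD => b_le a_ge; apply: lerB.
Qed.
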